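(* Let $\Gamma\subset\mathbb{C}$ be a planar lattice with multiplier ring $\mathrm{MR}(\Gamma)=\mathcal{O}\neq\mathbb{Z}$. Then there is an index-preserving bijection between the similar sublattices of $\Gamma$ and the non-zero principal ideals of $\mathcal{O}$ (the index of a similar sublattice $\Lambda$ being $[\Gamma:\Lambda]$ and the index of an ideal $\mathfrak{a}$ being $[\mathcal{O}:\mathfrak{a}]$). The Dirichlet series generating function for the number of similar sublattices of $\Gamma$ of a given index is thus given by the Dirichlet series for the non-zero principal ideals of $\mathcal{O}$, that is, $$\sum_{m=1}^{\infty}\frac{f(m)}{m^s}\;=\;\sum_{\substack{0\neq\mathfrak{a}\subset\mathcal{O}\\ \mathfrak{a}\text{ a principal ideal}}}\frac{1}{[\mathcal{O}:\mathfrak{a}]^s},$$ where $f(m)$ denotes the number of distinct similar sublattices of $\Gamma$ of index $m$.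
   Context: A planar lattice is a co-compact discrete subgroup of $\mathbb{C}\cong\mathbb{R}^2$. The multiplier ring of $\Gamma$ is the ring $\mathrm{MR}(\Gamma):=\{a\in\mathbb{C}\mid a\Gamma\subset\Gamma\}$, which contains $\mathbb{Z}$; when it is not equal to $\mathbb{Z}$, it is an order in an imaginary quadratic field. A similar sublattice (SSL) of $\Gamma$ is a sublattice of the form $a\Gamma\subset\Gamma$ with $0\neq a\in\mathbb{C}$ (only orientation-preserving similarities are considered). The Dirichlet series $\sum_m f(m)m^{-s}$ converges absolutely at least for $\mathrm{Re}(s)>2$. *)

(* Defs.v *)
From HB Require Import structures.
From mathcomp Require Import all_boot all_order all_algebra finmap generic_quotient.
From mathcomp Require Import complex.
From mathcomp Require Import all_classical all_reals all_analysis.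
From mathcomp.analysis.showcase Require summability.

Set Implicit Arguments.
Unset Strict Implicit.
Unset Printing Implicit Defensive.

Import Order.TTheory GRing.Theory Num.Theory.
Import numFieldNormedType.Exports.

Local Open Scope classical_set_scope.
Local Open Scope ring_scope.
Local Open Scope complex_scope.

(* The usual topology of the complex numbers, given by the modulus. *)
HB.instance Definition _ (R : realType) :=
  PseudoMetricNormedZmod.copy R[i] R[i]^o.

Section AdditiveSubgroups.
Variable V : zmodType.

Definition add_coset (G : set V) (x : V) : set V := [set x + y | y in G].

Definition add_cosets (G H : set V) : set (set V) := add_coset H @` G.

(* The value is 0 when there are infinitely many cosets. *)
Definition subgroup_index (G H : set V) : nat :=
  #|` fset_set (add_cosets G H) |%fset.

Definition coset_eq (G : set V) : rel V :=
  fun x y => `[< add_coset G x = add_coset G y >].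

Lemma coset_eq_equiv (G : set V) : equiv_class_of (coset_eq G).
Proof.
split=> [x|x y|y x z]; rewrite /coset_eq.
- exact/asboolP.
- by apply/asboolP/asboolP => ->.
- by move=> /asboolP-> /asboolP->; exact/asboolP.
Qed.

Canonical coset_eq_equiv_rel (G : set V) := EquivRelPack (coset_eq_equiv G).

End AdditiveSubgroups.

Section PlanarLattices.
Variable R : realType.
Implicit Types (G O L I : set R[i]) (a s z : R[i]).

(* R[i] / G with its quotient topology (two points are identified when their
   cosets modulo G coincide). *)
Definition complex_quotient G : topologicalType :=
  quotient_topology {eq_quot (coset_eq G)}%qT.

Definition planar_lattice G : Prop :=
  [/\ zmod_closed (mem G),
      G `<=` isolated G
    & compact [set: complex_quotient G]].

Definition dilate a G : set R[i] := [set a * x | x in G].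

Definition multiplier_ring G : set R[i] := [set a | dilate a G `<=` G].

Definition similar_sublattices G : set (set R[i]) :=
  [set L | exists a, [/\ a != 0, L = dilate a G & L `<=` G]].

Definition nonzero_principal_ideals O : set (set R[i]) :=
  [set I | (exists2 a, O a & I = dilate a O) /\ I <> [set 0]].

Definition similar_sublattices_of_index G (m : nat) : set (set R[i]) :=
  [set L | similar_sublattices G L /\ subgroup_index G L = m].

(* Meaningful when finitely many similar sublattices have index m, and 0
   otherwise. *)
Definition ssl_count G (m : nat) : nat :=
  #|` fset_set (similar_sublattices_of_index G m) |%fset.

Definition expC z : R[i] :=
  (expR (complex.Re z) * cos (complex.Im z))
    +i* (expR (complex.Re z) * sin (complex.Im z)).

(* n ^ s for n > 0. *)
Definition natpowC (n : nat) s : R[i] := expC (s * (ln n%:R)%:C).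

(* The term of index k is the one of m = k + 1. *)
Definition ssl_dirichlet_term G s : R[i] ^nat :=
  [sequence (ssl_count G k.+1)%:R / natpowC k.+1 s]_k.

(* Extended by 0 outside of the non-zero principal ideals of O, so that a sum
   over all subsets of R[i] is a sum over those ideals. *)
Definition ideal_dirichlet_term O s (I : set R[i]) : R[i] :=
  if I \in nonzero_principal_ideals O
  then 1 / natpowC (subgroup_index O I) s else 0.

End PlanarLattices.

(* Main.v *)
Require Import Defs.
From HB Require Import structures.
From mathcomp Require Import all_boot all_order all_algebra finmap.
From mathcomp Require Import complex.
From mathcomp Require Import all_classical all_reals all_analysis.
From mathcomp.analysis.showcase Require summability.
From mathcomp Require Import zify ring lra.

Import Order.TTheory GRing.Theory Num.Theory.
Import numFieldNormedType.Exports.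
Import Normc.

Local Open Scope classical_set_scope.
Local Open Scope ring_scope.
Local Open Scope complex_scope.

(** Write O for the multiplier ring of the lattice G. For nonzero a and b, the
    inclusions of a G in b G and of a O in b O both say that a / b lies in O, so
    sending a G to a O is a well defined bijection from the similar sublattices
    onto the nonzero principal ideals ([ideal_of_sublattice_bij]).

    The indices agree without any determinant. For a nonzero g in G, the subgroup
    g O of G has finite index, and the chains of a g O in a G in G and of a g O in
    g O in G, together with the invariance of the index under dilation, give
    [G : a G] [G : g O] = [G : g O] [O : a O] ([index_dilate_module]). Finiteness
    of all these indices comes from discreteness: a subgroup containing u and w u
    for some nonzero u and nonreal w meets every coset in a bounded region, and a
    discrete set has finitely many points there ([discrete_finite_index]). Such a
    w exists in O because O is itself discrete, its nonzero elements having
    modulus at least 1; a real element of O is therefore an integer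
    ([multiplier_ring_nonreal]).

    For the Dirichlet series it is enough to know that |a| <= [O : a O]
    ([normc_le_index]), since two of the integers 0, ..., [O : a O] are congruent
    modulo a O. The elements of O sit in distinct squares of a grid, whose
    coordinates (i, j) satisfy i, j = O(|a|); hence the sum of [O : I] ^ (- t) over
    any finite set of ideals is bounded by a constant times the square of the sum
    of the n ^ (- t / 2), which converges for t > 2 ([ideal_sum_bounded]). A
    family whose finite sums of moduli are bounded is summable to the same limit
    along its finite subsets and along any grading with finite pieces
    ([graded_sum]), and the graded sum of the ideals is the series of the
    similar sublattices, because there are as many of each in every index. *)

(** * Indices of subgroups *)

Definition subgroup {V : zmodType} (G : set V) : Prop :=
  G 0 /\ forall x y, G x -> G y -> G (x - y).

Lemma subgroup_zmod_closed {V : zmodType} (G : set V) :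
  zmod_closed (mem G) -> subgroup G.
Proof.
move=> [G0 GB]; split=> [|x y Gx Gy]; first by move: G0; rewrite inE.
by have := GB x y; rewrite !inE; apply.
Qed.

Lemma subgroupN {V : zmodType} {G : set V} {x} : subgroup G -> G x -> G (- x).
Proof. by move=> [G0 GB] Gx; rewrite -sub0r; exact: GB. Qed.

Lemma subgroupD {V : zmodType} {G : set V} {x y} :
  subgroup G -> G x -> G y -> G (x + y).
Proof. by move=> sG Gx Gy; rewrite -[y]opprK; apply: sG.2 => //; exact: subgroupN. Qed.

Lemma add_coset_eqP {V : zmodType} {H : set V} {x y} : subgroup H ->
  add_coset H x = add_coset H y <-> H (x - y).
Proof.
move=> sH; split=> [eqxy|Hxy].
  have : add_coset H x x by exists 0; rewrite ?addr0//; exact: sH.1.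
  by rewrite eqxy => -[h Hh <-]; rewrite addrC addKr.
apply/seteqP; split=> z [h Hh <-].
  by exists (x - y + h); [exact: subgroupD|rewrite addrA subrKC].
exists (h - (x - y)); first exact: sH.2.
by rewrite opprB addrCA subrKC addrC.
Qed.

(** Both sides are 0 when the sets are infinite. *)
Lemma card_eq_fset_set {T U : choiceType} {A : set T} {B : set U} :
  (A #= B)%card -> #|` fset_set A|%fset = #|` fset_set B|%fset.
Proof.
move=> AB; have [fA|iA] := pselect (finite_set A).
  have fB : finite_set B by rewrite -(eq_finite_set AB).
  exact/fcard_eq.
have iB : ~ finite_set B by rewrite -(eq_finite_set AB).
rewrite /fset_set; case: pselect => // _; case: pselect => //.
Qed.

Lemma card_fsetX {T U : choiceType} (A : {fset T}) (B : {fset U}) :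
  #|` A `*` B|%fset = (#|` A|%fset * #|` B|%fset)%N.
Proof.
rewrite /fsetM (perm_size (enum_imfset2 _ _)) ?size_allpairs//.
by move=> [? ?] [? ?] _ _ /= [-> ->].
Qed.

Lemma translate_coset {V : zmodType} (H : set V) x y :
  [set x + z | z in add_coset H y] = add_coset H (x + y).
Proof.
by rewrite /add_coset image_comp; apply: eq_imagel => z _ /=; rewrite addrA.
Qed.

(** The default value 0 of the choice is harmless: a coset is never empty. *)
Lemma coset_representative {V : zmodType} {G K C : set V} :
  subgroup G -> subgroup K -> K `<=` G -> add_cosets G K C ->
  G (xget 0 C) /\ C = add_coset K (xget 0 C).
Proof.
move=> sG sK KG [x Gx <-].
have : add_coset K x (xget 0 (add_coset K x)).
  by apply: (@xgetPex _ 0); exists x; exists 0; rewrite ?addr0//; exact: sK.1.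
move=> [k Kk <-]; split; first by apply: subgroupD => //; exact: KG.
by apply/add_coset_eqP => //; rewrite opprD addNKr; exact: subgroupN.
Qed.

(** Translating a coset of H in K by a chosen representative of a coset of K in G
    gives each coset of H in G exactly once. *)
Lemma index_tower {V : zmodType} {G K H : set V} :
  subgroup G -> subgroup K -> subgroup H -> H `<=` K -> K `<=` G ->
  finite_set (add_cosets G K) -> finite_set (add_cosets K H) ->
  subgroup_index G H = (subgroup_index G K * subgroup_index K H)%N.
Proof.
move=> sG sK sH HK KG fGK fKH.
pose f (CD : set V * set V) : set V := [set xget 0 CD.1 + y | y in CD.2].
have imf : f @` (add_cosets G K `*` add_cosets K H) = add_cosets G H.
  apply/seteqP; split=> [_ [[C D] [/= CGK [y Ky <-]] <-]|_ [x Gx <-]].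
    rewrite /f /= translate_coset; exists (xget 0 C + y) => //.
    by apply: subgroupD => //; [exact: (coset_representative sG sK KG CGK).1|exact: KG].
  set C := add_coset K x.
  have CGK : add_cosets G K C by exists x.
  have [_ /(add_coset_eqP sK) Kx] := coset_representative sG sK KG CGK.
  exists (C, add_coset H (x - xget 0 C)).
    by split=> //; exists (x - xget 0 C).
  by rewrite /f /= translate_coset subrKC.
have injf : {in add_cosets G K `*` add_cosets K H &, injective f}.
  move=> [C D] [C' D'] /[!inE] -[/= CGK [y Ky eD]] [/= CGK' [y' Ky' eD']].
  have [_ rC] := coset_representative sG sK KG CGK.
  have [_ rC'] := coset_representative sG sK KG CGK'.
  rewrite /f /= -eD -eD' !translate_coset => /(add_coset_eqP sH) Hyy'.
  have eC : C = C'.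
    rewrite rC rC'; apply/add_coset_eqP => //.
    rewrite (_ : _ - _ = (xget 0 C + y - (xget 0 C' + y')) - (y - y')); last first.
      by rewrite opprD addrACA addrK.
    by apply: sK.2; [exact: HK|exact: sK.2].
  congr pair => //; apply/add_coset_eqP => //.
  by move: Hyy'; rewrite eC opprD addrACA subrr add0r.
rewrite /subgroup_index -imf (card_eq_fset_set (inj_card_eq injf)).
by rewrite fset_setX// card_fsetX.
Qed.

Lemma subgroup_index_gt0 {V : zmodType} {G H : set V} : G 0 ->
  finite_set (add_cosets G H) -> (0 < subgroup_index G H)%N.
Proof.
move=> G0 fGH; rewrite /subgroup_index cardfs_gt0; apply/fset0Pn.
by exists (add_coset H 0); rewrite in_fset_set// inE; exists 0.
Qed.

Section Dilation.
Context {R : realType}.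
Implicit Types (G H O : set R[i]) (a b g : R[i]).

Lemma dilateM a b G : dilate a (dilate b G) = dilate (a * b) G.
Proof.
by rewrite /dilate image_comp; apply: eq_imagel => z _ /=; rewrite mulrA.
Qed.

Lemma dilate1 G : dilate 1 G = G.
Proof.
by apply/seteqP; split=> [_ [x Gx <-]|x Gx]; [rewrite mul1r|exists x; rewrite ?mul1r].
Qed.

Lemma dilateS {a G H} : G `<=` H -> dilate a G `<=` dilate a H.
Proof. exact: image_subset. Qed.

Lemma dilateP {a G x} : a != 0 -> dilate a G x <-> G (a^-1 * x).
Proof.
move=> a0; split=> [[y Gy <-]|Gx]; first by rewrite mulKf.
by exists (a^-1 * x) => //; rewrite mulVKf.
Qed.

Lemma subgroup_dilate a {G} : subgroup G -> subgroup (dilate a G).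
Proof.
move=> [G0 GB]; split=> [|_ _ [x Gx <-] [y Gy <-]].
  by exists 0; rewrite ?mulr0.
by exists (x - y); [exact: GB|rewrite mulrBr].
Qed.

Lemma index_dilate {a G H} : a != 0 ->
  subgroup_index (dilate a G) (dilate a H) = subgroup_index G H.
Proof.
move=> a0.
have cosetE x : add_coset (dilate a H) (a * x) = dilate a (add_coset H x).
  rewrite /dilate /add_coset !image_comp.
  by apply: eq_imagel => z _ /=; rewrite mulrDr.
have dI : injective (dilate a).
  by move=> A B AB; rewrite -[A]dilate1 -[B]dilate1 -(mulVf a0) -!dilateM AB.
rewrite /subgroup_index (_ : add_cosets _ _ = dilate a @` add_cosets G H).
  by apply: card_eq_fset_set; apply: inj_card_eq => A B _ _; exact: dI.
rewrite /add_cosets {1}/dilate !image_comp.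
by apply: eq_imagel => x _ /=; rewrite cosetE.
Qed.

(** Computing the index of a g O in G through a G and through g O gives
    [G : a G] [G : g O] = [G : g O] [O : a O], and [G : g O] cancels. *)
Lemma index_dilate_module {a g G O} :
  a != 0 -> g != 0 -> subgroup G -> subgroup O ->
  dilate a G `<=` G -> dilate a O `<=` O -> dilate g O `<=` G ->
  finite_set (add_cosets G (dilate a G)) ->
  finite_set (add_cosets (dilate a G) (dilate a (dilate g O))) ->
  finite_set (add_cosets G (dilate g O)) ->
  finite_set (add_cosets (dilate g O) (dilate g (dilate a O))) ->
  subgroup_index G (dilate a G) = subgroup_index O (dilate a O).
Proof.
move=> a0 g0 sG sO aG aO gO f1 f2 f3 f4.
have swap : dilate g (dilate a O) = dilate a (dilate g O).
  by rewrite !dilateM mulrC.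
have sgO := subgroup_dilate g sO; have sagO := subgroup_dilate a sgO.
have := index_tower sG (subgroup_dilate a sG) sagO (dilateS gO) aG f1 f2.
rewrite -{1}swap (index_tower sG sgO _ (dilateS aO) gO f3 f4); last by rewrite swap.
rewrite !index_dilate// mulnC => /eqP.
by rewrite eqn_pmul2r ?(subgroup_index_gt0 sG.1)// => /eqP.
Qed.

End Dilation.

(** * Discrete sets of complex numbers *)

Section Modulus.
Context {R : realType}.
Implicit Types z : R[i].

Lemma normc_ge0 z : 0 <= normc z.
Proof. by case: z => x y; exact: sqrtr_ge0. Qed.

Lemma normc_eq0 z : (normc z == 0) = (z == 0).
Proof. by apply/eqP/eqP => [/eq0_normc//|->]; exact: normc0. Qed.

Lemma normc_gt0 z : (0 < normc z) = (z != 0).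
Proof. by rewrite lt_neqAle normc_ge0 andbT eq_sym normc_eq0. Qed.

Lemma normcR (x : R) : normc x%:C = `|x|.
Proof. by rewrite /= expr0n/= addr0 sqrtr_sqr. Qed.

Lemma normc_nat (n : nat) : normc (n%:R : R[i]) = n%:R :> R.
Proof. by rewrite -(rmorph_nat (real_complex R)) normcR normr_nat. Qed.

Lemma normcX z n : normc (z ^+ n) = normc z ^+ n.
Proof.
by elim: n => [|n IHn]; rewrite ?expr0 ?exprS ?normcM ?IHn//; exact: normc1.
Qed.

Lemma normr_Re z : `|complex.Re z| <= normc z.
Proof.
by case: z => x y /=; rewrite -sqrtr_sqr ler_wsqrtr// lerDl sqr_ge0.
Qed.

Lemma normr_Im z : `|complex.Im z| <= normc z.
Proof.
by case: z => x y /=; rewrite -sqrtr_sqr ler_wsqrtr// lerDr sqr_ge0.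
Qed.

Lemma normc_le z : normc z <= `|complex.Re z| + `|complex.Im z|.
Proof.
case: z => x y /=; rewrite -[leRHS]ger0_norm ?addr_ge0//.
rewrite -sqrtr_sqr ler_wsqrtr// sqrrD !real_normK ?num_real// -addrAC lerDl.
by rewrite pmulrn_lge0// mulr_ge0.
Qed.

End Modulus.

(** Natural numbers index the squares of the grid, so that sums over squares
    become sums over pairs of natural numbers. *)
Definition nat_of_int (z : int) : nat :=
  match z with Posz n => n.*2 | Negz n => n.*2.+1 end.

Lemma nat_of_int_inj : injective nat_of_int.
Proof.
move=> [m|m] [n|n] /= => [/double_inj->//|e|e|[/double_inj->//]].
- by have := congr1 odd e; rewrite /= !odd_double.
- by have := congr1 odd e; rewrite /= !odd_double.
Qed.

Lemma nat_of_int_le z : (nat_of_int z <= 2 * `|z|)%N.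
Proof. by case: z => n /=; rewrite ?absz_nat -?mul2n//; lia. Qed.

Section UniformlyDiscrete.
Context {R : realType}.
Implicit Types (G H : set R[i]) (d : R).

Definition uniformly_discrete d G : Prop :=
  {in G &, forall x y, normc (x - y) < d -> x = y}.

Definition grid_cell d (x : R) : nat := nat_of_int (Num.floor (2 / d * x)).

Lemma grid_cell_eq {d x y} : 0 < d ->
  grid_cell d x = grid_cell d y -> `|x - y| < d / 2.
Proof.
move=> d0 /nat_of_int_inj eqxy.
have := floor_itv (2 / d * x); have := floor_itv (2 / d * y).
rewrite eqxy intrD; set k := (Num.floor _)%:~R => /andP[? ?] /andP[? ?].
have u0 : 0 < 2 / d by rewrite divr_gt0.
rewrite -[ltRHS]invf_div -[ltRHS]mulr1 ltr_pdivlMl//.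
rewrite -{1}(gtr0_norm u0) -normrM mulrBr ltr_norml.
by apply/andP; split; lra.
Qed.

Lemma grid_cell_le {d} x : 0 < d ->
  (grid_cell d x).+1%:R <= (4 / d + 3) * (1 + `|x|).
Proof.
move=> d0; set k := Num.floor (2 / d * x).
have kle : (absz k)%:R <= 2 / d * `|x| + 1 :> R.
  have /andP[k1 k2] := floor_itv (2 / d * x).
  rewrite -[_%:R]/((absz k)%:~R) abszE intr_norm.
  have -> : 2 / d * `|x| = `|2 / d * x|.
    by rewrite normrM (ger0_norm (divr_ge0 _ (ltW d0))).
  rewrite intrD -/k in k2; rewrite -/k in k1.
  have := ler_norm (2 / d * x); have := ler_norm (- (2 / d * x)).
  by rewrite normrN ler_norml => ? ?; apply/andP; split; lra.
have : (grid_cell d x).+1%:R <= 2 * (absz k)%:R + 1 :> R.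
  by rewrite -natrM -natr1 lerD2r ler_nat nat_of_int_le.
have : 0 <= `|x| by [].
have : 0 < d^-1 by rewrite invr_gt0.
have : 0 <= d^-1 * `|x| by rewrite mulr_ge0// invr_ge0 ltW.
by lra.
Qed.

(** With mesh d / 2, a square meets a set of points at mutual distance at least d
    at most once; its coordinates, listed as natural numbers, grow linearly with
    the modulus. *)
Definition grid d (z : R[i]) : nat * nat :=
  (grid_cell d (complex.Re z), grid_cell d (complex.Im z)).

Lemma grid_inj {d G} : 0 < d -> uniformly_discrete d G ->
  {in G &, injective (grid d)}.
Proof.
move=> d0 sepG x y Gx Gy [/(grid_cell_eq d0) dRe /(grid_cell_eq d0) dIm].
apply: sepG => //; apply: le_lt_trans (normc_le _) _.
by rewrite !raddfB; lra.
Qed.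

Lemma grid_le {d} z : 0 < d ->
  ((grid d z).1.+1%:R <= (4 / d + 3) * (1 + normc z)) /\
  ((grid d z).2.+1%:R <= (4 / d + 3) * (1 + normc z)).
Proof.
move=> d0; have D0 : 0 < 4 / d + 3 by rewrite addr_gt0// divr_gt0.
split; apply: le_trans (grid_cell_le _ d0) _; rewrite ler_pM2l// lerD2l.
  exact: normr_Re.
exact: normr_Im.
Qed.

Lemma discrete_finite {d G} (B : R) : 0 < d -> uniformly_discrete d G ->
  finite_set (G `&` [set z | normc z <= B]).
Proof.
move=> d0 sepG; set A := _ `&` _.
pose m := Num.bound ((4 / d + 3) * (1 + B)).
have injA : {in A &, injective (grid d)}.
  by move=> x y /[!inE] -[Gx _] [Gy _]; apply: (grid_inj d0 sepG); rewrite inE.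
rewrite -(eq_finite_set (inj_card_eq injA)).
apply: (sub_finite_set (B := `I_m `*` `I_m)); last exact: finite_setX.
move=> _ [z [_ /= zB] <-].
have mB : (4 / d + 3) * (1 + normc z) < m%:R.
  apply: le_lt_trans (archi_boundP _); last first.
    by rewrite mulr_ge0 ?addr_ge0 ?divr_ge0// ?(ltW d0)// (le_trans (normc_ge0 z)).
  by rewrite ler_pM2l ?lerD2l// addr_gt0// divr_gt0.
have [le1 le2] := grid_le z d0; split => /=.
  by rewrite -(ler_nat R) (le_trans le1)// ltW.
by rewrite -(ler_nat R) (le_trans le2)// ltW.
Qed.

(** Every point is (s + t w) u for some real s and t. Rounding s and t down moves
    it by at most |u| (1 + |w|), so the ball of that radius contains a
    representative of every coset. *)
Lemma discrete_finite_index {d G H} {u w : R[i]} : 0 < d -> uniformly_discrete d G ->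
  subgroup G -> subgroup H -> H `<=` G ->
  u != 0 -> complex.Im w != 0 -> H u -> H (w * u) ->
  finite_set (add_cosets G H).
Proof.
move=> d0 sepG sG sH HG u0 w0 Hu Hwu.
pose B := normc u * (1 + normc w).
have := discrete_finite B d0 sepG; set A := _ `&` _ => fA.
apply: sub_finite_set (finite_image (add_coset H) fA) => _ [x Gx <-].
pose t := complex.Im (x / u) / complex.Im w.
pose s := complex.Re (x / u) - t * complex.Re w.
have xE : x = (s%:C + t%:C * w) * u.
  rewrite -[LHS](divfK u0); congr (_ * _).
  rewrite {}/s {}/t; case: (x / u) w w0 {Hwu B A fA} => p q [a b] /= b0.
  by apply/eqP; rewrite eq_complex /=; apply/andP; split; apply/eqP; field.
have Hint (z : R[i]) (k : int) : H z -> H (z *~ k).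
  have Hnat n : H z -> H (z *+ n).
    move=> Hz; elim: n => [|n IHn]; first by rewrite mulr0n; exact: sH.1.
    by rewrite mulrS; exact: subgroupD.
  by case: k => n Hz; [exact: Hnat|apply: subgroupN => //; exact: Hnat].
(* The point of H obtained from x by rounding. *)
pose h := u *~ Num.floor s + (w * u) *~ Num.floor t.
have Hh : H h by apply: subgroupD => //; exact: Hint.
exists (x - h); last by apply/add_coset_eqP => //; rewrite addrAC subrr add0r; exact: subgroupN.
split; first by apply: sG.2 => //; exact: HG.
have frac (r : R) : normc ((r - (Num.floor r)%:~R)%:C) <= 1.
  rewrite normcR; have /andP[? ] := floor_itv r; rewrite intrD => ?.
  by rewrite ger0_norm; lra.
have -> : x - h = ((s - (Num.floor s)%:~R)%:C + (t - (Num.floor t)%:~R)%:C * w) * u.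
  rewrite xE /h -[u *~ _]mulrzl -[(w * u) *~ _]mulrzl !rmorphB /= !rmorph_int.
  by ring.
rewrite /= normcM mulrC; apply: ler_wpM2l; first exact: normc_ge0.
apply: le_trans (le_normcD _ _) _; apply: lerD; first exact: frac.
by rewrite normcM ler_piMl ?normc_ge0.
Qed.

End UniformlyDiscrete.

(** * Lattices and their multiplier rings *)

Section ComplexTopology.
Context {R : realType}.

(** The modulus defining the topology takes its values in the complex numbers;
    this measures the same neighbourhoods with real radii. *)
Lemma nbhs_complexP (z : R[i]) (A : set R[i]) :
  nbhs z A <-> exists2 d : R, 0 < d & forall y, normc (z - y) < d -> A y.
Proof.
split=> [/nbhs_normP[e /= e0 eA]|[d d0 dA]].
  exists (complex.Re e); first by move: e0; rewrite ltcE /= => /andP[].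
  move=> y zy; apply: eA => /=.
  change ((normc (z - y))%:C < e); rewrite ltcE /= zy andbT.
  by move: e0; rewrite ltcE /= => /andP[].
apply/nbhs_ballP; exists d%:C => /=; first by rewrite ltcR.
move=> y /= zy; apply: dA.
by move: zy; change ((normc (z - y))%:C < d%:C -> normc (z - y) < d); rewrite ltcR.
Qed.

Lemma continuous_Re : continuous (@complex.Re R : R[i] -> R).
Proof.
move=> z A /nbhs_ballP[e /= e0 eA]; apply/nbhs_complexP; exists e => // y zy.
by apply: eA; apply: le_lt_trans zy; rewrite -raddfB; exact: normr_Re.
Qed.

End ComplexTopology.

Section PlanarLattice.
Context {R : realType} {G : set R[i]}.
Hypothesis latG : planar_lattice G.

Lemma planar_lattice_subgroup : subgroup G.
Proof. by have [/subgroup_zmod_closed] := latG. Qed.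

Lemma planar_lattice_discrete : exists2 d : R, 0 < d & uniformly_discrete d G.
Proof.
have sG := planar_lattice_subgroup; have [_ isoG _] := latG.
have [_ [V /nbhs_complexP[d d0 dV] VG0]] := isoG _ sG.1.
exists d => // x y /[!inE] Gx Gy xyd.
have : (V `&` G) (x - y).
  by split; [apply: dV; rewrite sub0r normcN|exact: sG.2].
by rewrite VG0 => /eqP; rewrite subr_eq0 => /eqP.
Qed.

(** The quotient by the trivial group is the whole plane, on which the real part
    is continuous and unbounded. *)
Lemma planar_lattice_neq0 : exists2 g, G g & g != 0.
Proof.
have sG := planar_lattice_subgroup; have [_ _ cG] := latG.
apply: contrapT => noG.
have G0 g : G g -> g = 0.
  by move=> Gg; apply: contrapT => /eqP g0; apply: noG; exists g.
pose q : complex_quotient G -> R := @complex.Re R \o repr.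
have qpi z : q (\pi_(complex_quotient G)%qT z) = complex.Re z.
  rewrite /q /=; congr (complex.Re _); apply/eqP; rewrite -subr_eq0; apply/eqP.
  apply: G0; apply/(add_coset_eqP sG).
  by have /eqmodP/asboolP := reprK (\pi_(complex_quotient G)%qT z).
have cq : continuous q.
  apply/quotient_continuous; rewrite (_ : _ \o _ = @complex.Re R); last exact/funext.
  exact: continuous_Re.
have : compact (q @` [set: complex_quotient G]).
  by apply: continuous_compact => //; exact: continuous_subspaceT.
move=> /compact_bounded[M [_ /(_ (M + 1))]]; rewrite ltrDl ltr01 => /(_ isT).
move=> /(_ (`|M| + 2)) /= le_M1.
have : `| `|M| + 2 | <= M + 1.
  by apply: le_M1; exists (\pi_(complex_quotient G)%qT (`|M| + 2)%:C).
by rewrite ger0_norm ?addr_ge0//; have := ler_norm M; lra.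
Qed.

End PlanarLattice.

Section MultiplierRing.
Context {R : realType} {G : set R[i]}.
Hypothesis latG : planar_lattice G.
Local Notation O := (multiplier_ring G).
Let sG : subgroup G := planar_lattice_subgroup latG.

Lemma multiplier_ring1 : O 1.
Proof. by move=> _ [x Gx <-]; rewrite mul1r. Qed.

Lemma multiplier_ringM a b : O a -> O b -> O (a * b).
Proof.
move=> Oa Ob _ [x Gx <-]; rewrite -mulrA.
by apply: (Oa _); exists (b * x) => //; apply: (Ob _); exists x.
Qed.

Lemma multiplier_ring_subgroup : subgroup O.
Proof.
split=> [_ [x Gx <-]|a b Oa Ob _ [x Gx <-]]; first by rewrite mul0r; exact: sG.1.
by rewrite mulrBl; by apply: sG.2; [apply: (Oa _)|apply: (Ob _)]; exists x.
Qed.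

Lemma multiplier_ring_int (k : int) : O k%:~R.
Proof.
have Hnat n : O n%:R.
  elim: n => [|n IHn]; first exact: multiplier_ring_subgroup.1.
  rewrite -natr1; apply: (subgroupD multiplier_ring_subgroup) => //.
  exact: multiplier_ring1.
case: k => n; first exact: Hnat.
by rewrite NegzE mulrNz; exact: (subgroupN multiplier_ring_subgroup (Hnat n.+1)).
Qed.

(** The powers of a multiplier a with |a| < 1 would carry a nonzero lattice
    point arbitrarily close to 0. *)
Lemma multiplier_ring_ge1 a : O a -> a != 0 -> 1 <= normc a.
Proof.
move=> Oa a0; rewrite leNgt; apply/negP => a1.
have [d d0 sepG] := planar_lattice_discrete latG.
have [g Gg g0] := planar_lattice_neq0 latG.
have Oan n : O (a ^+ n).
  elim: n => [|n IHn]; first by rewrite expr0; exact: multiplier_ring1.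
  by rewrite exprS; exact: multiplier_ringM.
have g1 : 0 < normc g by rewrite normc_gt0.
have /cvgrPdist_lt : (fun n => normc a ^+ n) @ \oo --> (0 : R).
  by apply: cvg_expr; rewrite ger0_norm ?normc_ge0.
move=> /(_ _ (divr_gt0 d0 g1))[N _ /(_ N (leqnn N))] /=.
rewrite sub0r normrN ger0_norm ?exprn_ge0 ?normc_ge0// -normcX => aN.
have /eqP : a ^+ N * g = 0.
  apply: sepG; rewrite ?inE; [by apply: (Oan N); exists g|exact: sG.1|].
  by rewrite subr0 normcM -ltr_pdivlMr.
by rewrite mulf_eq0 expf_eq0 (negPf a0) (negPf g0) andbF.
Qed.

(** Distinct multipliers differ by a nonzero multiplier. *)
Lemma multiplier_ring_discrete : uniformly_discrete 1 O.
Proof.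
move=> x y /[!inE] Ox Oy; apply: contraPP => /eqP; rewrite -subr_eq0 => xy0.
apply/negP; rewrite -leNgt; apply: multiplier_ring_ge1 => //.
exact: multiplier_ring_subgroup.2.
Qed.

(** A real multiplier differs from its integral part by a multiplier in [0, 1[,
    which can only be 0. *)
Lemma multiplier_ring_nonreal : O <> range (intr : int -> R[i]) ->
  exists2 w, O w & complex.Im w != 0.
Proof.
move=> OZ; apply: contrapT => noO; apply: OZ; apply/seteqP.
split=> [w Ow|_ [k _ <-]]; last exact: multiplier_ring_int.
exists (Num.floor (complex.Re w)) => //; apply: multiplier_ring_discrete.
- by rewrite inE; exact: multiplier_ring_int.
- by rewrite inE.
have w0 : complex.Im w = 0.
  by apply: contrapT => /eqP w0; apply: noO; exists w.
have -> : w = (complex.Re w)%:C by apply/eqP; rewrite eq_complex/= w0 !eqxx.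
rewrite /= -(rmorph_int (real_complex R)) -rmorphB normcR distrC.
have /andP[? ] := floor_itv (complex.Re w); rewrite intrD => ?.
by rewrite ger0_norm; lra.
Qed.

End MultiplierRing.

(** * Similar sublattices and principal ideals *)

Section SimilarSublattices.
Context {R : realType} {G : set R[i]}.
Hypothesis latG : planar_lattice G.
Local Notation O := (multiplier_ring G).
Hypothesis O_neqZ : O <> range (intr : int -> R[i]).
Let sG : subgroup G := planar_lattice_subgroup latG.
Let sO : subgroup O := multiplier_ring_subgroup latG.

Lemma dilate_ideal_subset {a} : O a -> dilate a O `<=` O.
Proof. by move=> Oa _ [b Ob <-]; exact: multiplier_ringM. Qed.

Lemma similar_sublatticesP L : similar_sublattices G L <->
  exists a, [/\ a != 0, O a & L = dilate a G].
Proof. by split=> -[a [a0]] => [-> aG|aG ->]; exists a. Qed.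

Lemma nonzero_principal_idealsP I : nonzero_principal_ideals O I <->
  exists a, [/\ a != 0, O a & I = dilate a O].
Proof.
split=> [[[a Oa ->] neq0]|[a [a0 Oa ->]]].
  exists a; split=> //; apply/eqP => a0; apply: neq0; rewrite a0.
  apply/seteqP; split=> [_ [b _ <-]|_ ->]; first by rewrite mul0r.
  by exists 0; [exact: sO.1|rewrite mul0r].
split; first by exists a.
move=> /seteqP[/(_ a) + _] => /(_ _)/wrap[].
  by exists 1; [exact: multiplier_ring1|rewrite mulr1].
by move=> /= a00; move: a0; rewrite a00 eqxx.
Qed.

(** Both inclusions say that a / b is a multiplier of G. *)
Lemma dilate_subset_ideal {a b} : b != 0 ->
  dilate a G `<=` dilate b G <-> dilate a O `<=` dilate b O.
Proof.
move=> b0; split=> [aGbG|aObO].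
  have Oba : O (b^-1 * a).
    move=> _ [x Gx <-]; rewrite -mulrA; apply/(dilateP b0).
    by apply: aGbG; exists x.
  move=> _ [c Oc <-]; apply/(dilateP b0); rewrite mulrA.
  exact: multiplier_ringM.
have /(dilateP b0) Oba : dilate b O a.
  by apply: aObO; exists 1; [exact: multiplier_ring1|rewrite mulr1].
move=> _ [x Gx <-]; apply/(dilateP b0); rewrite mulrA.
by apply: (Oba _); exists x.
Qed.

Lemma dilate_eq_ideal {a b} : a != 0 -> b != 0 ->
  dilate a G = dilate b G <-> dilate a O = dilate b O.
Proof.
move=> a0 b0; split=> /seteqP[ab ba]; apply/seteqP; split.
- exact/(dilate_subset_ideal b0).
- exact/(dilate_subset_ideal a0).
- exact/(dilate_subset_ideal b0).
- exact/(dilate_subset_ideal a0).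
Qed.

(** Any dilation factor of L gives the same ideal, so one is chosen. *)
Definition ideal_of_sublattice (L : set R[i]) : set R[i] :=
  dilate (xget 0 [set a | a != 0 /\ L = dilate a G]) O.

Lemma ideal_of_dilate a : a != 0 ->
  ideal_of_sublattice (dilate a G) = dilate a O.
Proof.
move=> a0; rewrite /ideal_of_sublattice; set P := [set _ | _].
have [b0 ab] : P (xget 0 P) by apply: (@xgetPex _ 0); exists a.
exact/(dilate_eq_ideal b0 a0).
Qed.

Lemma ideal_of_sublattice_bij : set_bij (similar_sublattices G)
  (nonzero_principal_ideals O) ideal_of_sublattice.
Proof.
split.
- move=> L /similar_sublatticesP[a [a0 Oa ->]]; rewrite ideal_of_dilate//.
  by apply/nonzero_principal_idealsP; exists a.
- move=> L M /[!inE] /similar_sublatticesP[a [a0 _ ->]].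
  move=> /similar_sublatticesP[b [b0 _ ->]]; rewrite !ideal_of_dilate//.
  by move/(dilate_eq_ideal a0 b0).
- move=> I /nonzero_principal_idealsP[a [a0 Oa ->]].
  exists (dilate a G); last exact: ideal_of_dilate.
  by apply/similar_sublatticesP; exists a.
Qed.

Lemma ideal_finite_index {a} : O a -> a != 0 ->
  finite_set (add_cosets O (dilate a O)).
Proof.
move=> Oa a0; have [w Ow w0] := multiplier_ring_nonreal latG O_neqZ.
apply: (discrete_finite_index ltr01 (multiplier_ring_discrete latG) sO
  (subgroup_dilate a sO) (dilate_ideal_subset Oa) a0 w0).
  by exists 1; [exact: multiplier_ring1|rewrite mulr1].
by exists w => //; rewrite mulrC.
Qed.

(** With a nonreal multiplier w, a subgroup containing O u contains both u and
    w u. *)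
Lemma submodule_finite_index {G' H u} : subgroup G' -> subgroup H ->
  H `<=` G' -> G' `<=` G -> u != 0 -> (forall b, O b -> H (b * u)) ->
  finite_set (add_cosets G' H).
Proof.
move=> sG' sH HG' G'G u0 Hu.
have [d d0 discG] := planar_lattice_discrete latG.
have [w Ow w0] := multiplier_ring_nonreal latG O_neqZ.
apply: (discrete_finite_index d0 _ sG' sH HG' u0 w0).
- by move=> x y /[!inE] /G'G Gx /G'G Gy; apply: discG; rewrite inE.
- by rewrite -[u]mul1r; apply: Hu; exact: multiplier_ring1.
- exact: Hu.
Qed.

Lemma sublattice_finite_index {a} : O a -> a != 0 ->
  finite_set (add_cosets G (dilate a G)).
Proof.
move=> Oa a0; have [g Gg g0] := planar_lattice_neq0 latG.
apply: (submodule_finite_index (u := a * g)) => //.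
- exact: subgroup_dilate.
- by rewrite mulf_neq0.
- move=> b Ob; exists (b * g); last by rewrite mulrCA.
  by apply: (Ob _); exists g.
Qed.

Lemma index_sublattice_ideal {a} : O a -> a != 0 ->
  subgroup_index G (dilate a G) = subgroup_index O (dilate a O).
Proof.
move=> Oa a0; have [g Gg g0] := planar_lattice_neq0 latG.
have gO : dilate g O `<=` G.
  by move=> _ [b Ob <-]; rewrite mulrC; apply: (Ob _); exists g.
apply: (index_dilate_module a0 g0 sG sO Oa (dilate_ideal_subset Oa) gO).
- exact: sublattice_finite_index.
- apply: (submodule_finite_index (u := a * g)) => //.
  + exact: subgroup_dilate.
  + exact/subgroup_dilate/subgroup_dilate.
  + exact: dilateS.
  + by rewrite mulf_neq0.
  + by move=> b Ob; exists (g * b); [exists b|ring].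
- apply: (submodule_finite_index (u := g)) => //.
  + exact: subgroup_dilate.
  + by move=> b Ob; exists b; rewrite // mulrC.
- apply: (submodule_finite_index (u := g * a)) => //.
  + exact: subgroup_dilate.
  + exact/subgroup_dilate/subgroup_dilate.
  + exact/dilateS/dilate_ideal_subset.
  + by rewrite mulf_neq0.
  + by move=> b Ob; exists (a * b); [exists b|ring].
Qed.

(** Of the integers 0, ..., n, where n is the index, two are congruent modulo a O;
    their difference is at most n and is the product of a with a nonzero
    multiplier, of modulus at least 1. *)
Lemma normc_le_index {a} : O a -> a != 0 ->
  normc a <= (subgroup_index O (dilate a O))%:R.
Proof.
move=> Oa a0; have fO := ideal_finite_index Oa a0.
rewrite leNgt; apply/negP; set n := subgroup_index _ _ => na.
pose c (k : nat) := add_coset (dilate a O) k%:R.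
have injc : {in `I_n.+1 &, injective c}.
  have half (k l : nat) : (k <= n)%N -> c k = c l -> (k <= l)%N.
    move=> kn /(add_coset_eqP (subgroup_dilate a sO))[b Ob ab].
    rewrite leqNgt; apply/negP => lk.
    have kl0 : (k%:R - l%:R : R[i]) = (k - l)%:R by rewrite natrB// ltnW.
    have b0 : b != 0.
      apply/eqP => b0; move: ab; rewrite b0 mulr0 kl0 => /esym/eqP.
      by rewrite pnatr_eq0 subn_eq0 leqNgt lk.
    have := multiplier_ring_ge1 latG b Ob b0.
    have : normc a * normc b = (k - l)%:R by rewrite -normcM ab kl0 normc_nat.
    have : (k - l)%:R <= n%:R :> R by rewrite ler_nat (leq_trans (leq_subr _ _)).
    by move=> le_n eq_ab b1; have := ler_peMr (normc_ge0 a) b1; lra.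
  move=> k l /[!inE] /= kn ln ckl; apply/eqP; rewrite eqn_leq.
  by rewrite (half k l kn ckl) (half l k ln (esym ckl)).
suff : (n.+1 <= n)%N by rewrite ltnn.
have := card_eq_fset_set (inj_card_eq injc).
rewrite (card_fset_set (card_eqxx `I_n.+1)) => <-.
apply: fsubset_leq_card; rewrite -fset_set_sub//; last exact: finite_image.
move=> _ [k _ <-]; exists k%:R => //.
exact: (multiplier_ring_int latG k).
Qed.

Definition ideals_of_index (m : nat) : set (set R[i]) :=
  [set I | nonzero_principal_ideals O I /\ subgroup_index O I = m].

Lemma ssl_of_index_card_eq m :
  (similar_sublattices_of_index G m #= ideals_of_index m)%card.
Proof.
have [phiS phiI phiJ] := ideal_of_sublattice_bij.
have imE : ideals_of_index m =
    ideal_of_sublattice @` similar_sublattices_of_index G m.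
  apply/seteqP; split=> [I [/[dup] /phiJ[L SL <-] _ indL]|_ [L [SL indL] <-]].
    exists L => //; split=> //; move: SL indL.
    move=> /similar_sublatticesP[a [a0 Oa ->]].
    by rewrite ideal_of_dilate// index_sublattice_ideal.
  split; first exact: phiS.
  move: SL indL => /similar_sublatticesP[a [a0 Oa ->]].
  by rewrite ideal_of_dilate// index_sublattice_ideal.
rewrite imE card_eq_sym; apply: inj_card_eq => L M /[!inE] -[SL _] [SM _].
by apply: phiI; rewrite inE.
Qed.

(** The generators of these ideals lie in a disc of radius m. *)
Lemma ideals_of_index_finite m : finite_set (ideals_of_index m).
Proof.
have := discrete_finite m%:R ltr01 (multiplier_ring_discrete latG).
move=> /(finite_image (fun a => dilate a O)); apply: sub_finite_set.
move=> _ [/nonzero_principal_idealsP[a [a0 Oa ->]] ind].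
by exists a => //; split=> //=; rewrite -ind; exact: normc_le_index.
Qed.

End SimilarSublattices.

(** * Sums over principal ideals *)

Section SumBounds.
Context {R : realType}.

Lemma ler_sum_uniq_subset {T : eqType} (s s' : seq T) (F : T -> R) :
  uniq s -> uniq s' -> {subset s <= s'} -> (forall x, 0 <= F x) ->
  \sum_(x <- s) F x <= \sum_(x <- s') F x.
Proof.
move=> us us' ss' F0; rewrite [leRHS](bigID (mem s)) /= -[X in _ <= X + _]big_filter.
have pss' : perm_eq s [seq x <- s' | x \in s].
  apply: uniq_perm; rewrite ?filter_uniq// => x; rewrite mem_filter.
  by case: (boolP (x \in s)) => // /ss' ->.
by rewrite [leLHS](perm_big _ pss') /= lerDl; apply: sumr_ge0.
Qed.

(** Injectivity of q makes the sum part of the expansion of a product of two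
    finite sums of h. *)
Lemma sum_pairs_le {T : choiceType} (J : {fset T}) (q : T -> nat * nat)
    (h : nat -> R) (Z : R) :
  (forall n, 0 <= h n) -> (forall n, \sum_(0 <= k < n) h k <= Z) ->
  {in J &, injective q} ->
  \sum_(x <- J) h (q x).1 * h (q x).2 <= Z * Z.
Proof.
move=> h0 hZ injq.
pose m := (\max_(x <- J) maxn (q x).1 (q x).2).+1.
have qm x : x \in J -> ((q x).1 < m)%N /\ ((q x).2 < m)%N.
  move=> xJ; rewrite !ltnS.
  have := @leq_bigmax_seq _ (enum_fset J) predT (fun x => maxn (q x).1 (q x).2) x xJ isT.
  by rewrite geq_max => /andP[].
pose F (p : nat * nat) := h p.1 * h p.2.
have F0 p : 0 <= F p by rewrite mulr_ge0.
rewrite -[leLHS](big_map q predT F).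
apply: (@le_trans _ _ (\sum_(p <- [seq (i, j) | i <- iota 0 m, j <- iota 0 m]) F p)).
  apply: ler_sum_uniq_subset => //; first by rewrite map_inj_in_uniq// fset_uniq.
    by apply: allpairs_uniq; rewrite ?iota_uniq// => -[? ?] [? ?] _ _ [-> ->].
  move=> _ /mapP[x xJ ->]; have [q1 q2] := qm x xJ.
  by apply/allpairsP; exists (q x); rewrite !mem_iota/= -surjective_pairing.
rewrite (_ : iota 0 m = index_iota 0 m); last by rewrite /index_iota subn0.
rewrite big_allpairs (eq_bigr (fun i => h i * \sum_(0 <= j < m) h j)); last first.
  by move=> i _; rewrite mulr_sumr.
rewrite -mulr_suml; apply: ler_pM => //; exact: sumr_ge0.
Qed.

(** Makes the sum of the powers n ^ (- (1 + e)) telescope. It is a mean value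
    inequality for x ^ (- e), derived from exp y >= 1 + y and ln (1 + y) <= y. *)
Lemma powR_telescope (e : R) (n : nat) : 0 < e -> (0 < n)%N ->
  (n.+1%:R `^ (1 + e))^-1 <= ((n%:R `^ e)^-1 - (n.+1%:R `^ e)^-1) / e.
Proof.
move=> e0 n0; have n0R : 0 < n%:R :> R by rewrite ltr0n.
have n1 : 0 < n.+1%:R :> R by rewrite ltr0n.
have ratio : 1 + e / n.+1%:R <= (n%:R / n.+1%:R : R) `^ (- e).
  rewrite /powR gt_eqF ?divr_gt0//.
  apply: le_trans (expR_ge1Dx _); rewrite lerD2l mulNr -mulrN ler_pM2l//.
  have -> : n%:R / n.+1%:R = 1 + (- n.+1%:R^-1) :> R.
    by rewrite -natr1; field; rewrite natr1 pnatr_eq0.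
  rewrite lerNr; apply: le_ln1Dx.
  by rewrite ltrN2 invf_lt1// ltr1n.
rewrite ler_pdivlMr// powRD; last by rewrite pnatr_eq0 implybT.
rewrite powRr1 ?ler0n// invfM.
have -> : (n%:R `^ e)^-1 = (n%:R / n.+1%:R) `^ (- e) * (n.+1%:R `^ e)^-1.
  rewrite powRM ?invr_ge0 ?ler0n// powRN -mulrA -[LHS]mulr1; congr (_ * _).
  rewrite -powR_inv1 ?ler0n// -powRrM mulN1r opprK divff//.
rewrite -[X in _ - X]mul1r -mulrBl mulrAC; apply: ler_wpM2r.
  by rewrite invr_ge0 powR_ge0.
by rewrite lerBrDl mulrC.
Qed.

Lemma riemannR_sum_le (e : R) (n : nat) : 0 < e ->
  \sum_(0 <= k < n) riemannR (1 + e) k <= 1 + e^-1.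
Proof.
move=> e0.
suff Hn m : \sum_(0 <= k < m.+1) riemannR (1 + e) k
             <= 1 + (1 - (m.+1%:R `^ e)^-1) / e.
  case: n => [|n].
    by rewrite big_geq// addr_ge0// invr_ge0 ltW.
  apply: le_trans (Hn n) _; rewrite lerD2l -[leRHS]mul1r.
  by rewrite ler_pM2r ?invr_gt0// lerBlDr lerDl invr_ge0 powR_ge0.
elim: m => [|m IHm].
  by rewrite big_nat1 /riemannR !powR1 invr1 subrr mul0r addr0.
rewrite big_nat_recr//=.
apply: le_trans (lerD IHm (@powR_telescope e m.+1 e0 isT)) _.
by rewrite -addrA -mulrDl addrA subrK.
Qed.

End SumBounds.

Section IdealSum.
Context {R : realType} {G : set R[i]}.
Hypothesis latG : planar_lattice G.
Local Notation O := (multiplier_ring G).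
Hypothesis O_neqZ : O <> range (intr : int -> R[i]).

(** A generator a of an ideal of index N satisfies |a| <= N, so both numbers of
    its grid cell are O(N): the sum is at most a constant times the square of
    the sum of the (k + 1) ^ (- t / 2), which converges for t > 2. *)
Lemma ideal_sum_bounded (t : R) : 2 < t -> exists B : R,
  forall J : {fset set R[i]},
    {in J, forall I, nonzero_principal_ideals O I} ->
    \sum_(I <- J) ((subgroup_index O I)%:R `^ t)^-1 <= B.
Proof.
move=> t2; pose e : R := t / 2 - 1; have e0 : 0 < e by rewrite /e; lra.
(* By [grid_le], i + 1 <= 7 (1 + |a|) <= 14 N for both coordinates i. *)
pose c : R := (14 ^+ 2) `^ (t / 2).
exists (c * ((1 + e^-1) * (1 + e^-1))) => J JO.
pose gen (I : set R[i]) := xget 0 [set a | [/\ a != 0, O a & I = dilate a O]].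
have genP I : I \in J -> [/\ gen I != 0, O (gen I) & I = dilate (gen I) O].
  move=> /JO/(nonzero_principal_idealsP latG)[a aP].
  by apply: (@xgetPex _ 0 [set a | [/\ a != 0, O a & I = dilate a O]]); exists a.
pose q I := grid 1 (gen I).
have injq : {in J &, injective q}.
  move=> I I' IJ IJ' qII'; have [_ OI ->] := genP I IJ; have [_ OI' ->] := genP I' IJ'.
  congr (dilate _ O).
  by apply: (grid_inj ltr01 (multiplier_ring_discrete latG)) qII'; rewrite inE.
pose h := riemannR (1 + e).
have h0 n : 0 <= h n by apply/ltW/riemannR_gt0; rewrite addr_ge0// ltW.
have := sum_pairs_le J q h (1 + e^-1) h0 (fun n => riemannR_sum_le e n e0) injq.
have c0 : 0 < c by rewrite powR_gt0// exprn_gt0.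
rewrite -(ler_pM2l c0); apply: le_trans.
rewrite mulr_sumr [leLHS]big_seq [leRHS]big_seq; apply: ler_sum => I IJ.
have [a0 Oa IE] := genP I IJ.
set N : R := (subgroup_index O I)%:R.
have aN : normc (gen I) <= N.
  by rewrite /N [X in subgroup_index _ X]IE; exact: normc_le_index.
have a1 := multiplier_ring_ge1 latG _ Oa a0.
have N1 : 1 <= N := le_trans a1 aN.
have [q1 q2] := grid_le (gen I) (ltr01 : 0 < 1 :> R).
have q1N : (q I).1.+1%:R <= 14 * N by apply: le_trans q1 _; rewrite divr1; lra.
have q2N : (q I).2.+1%:R <= 14 * N by apply: le_trans q2 _; rewrite divr1; lra.
have eE : 1 + e = t / 2 by rewrite /e; lra.
rewrite /h /riemannR eE -invfM -powRM// -[c]invrK -invfM.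
rewrite lef_pV2 ?posrE ?mulr_gt0 ?invr_gt0 ?powR_gt0 ?mulr_gt0//; last first.
  exact: lt_le_trans ltr01 N1.
rewrite mulrC ler_pdivrMr//.
have -> : N `^ t = (N ^+ 2) `^ (t / 2).
  rewrite -powR_mulrn ?(le_trans ler01)// -powRrM; congr (_ `^ _).
  by field.
rewrite -powRM ?sqr_ge0//; apply: ge0_ler_powR; rewrite ?nnegrE ?mulr_ge0 ?sqr_ge0//.
  by lra.
by rewrite -exprMn [N * _]mulrC expr2; apply: ler_pM.
Qed.

End IdealSum.

(** * Unconditional summation in the complex plane *)

Section ComplexLimits.
Context {R : realType}.

Lemma cvg_complexP {T : Type} {F : set_system T} {FF : Filter F}
    (u : T -> R[i]) (l : R[i]) :
  u @ F --> l <-> forall d : R, 0 < d -> \forall x \near F, normc (l - u x) < d.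
Proof.
split=> [ul d d0|ul A /nbhs_complexP[d d0 dA]].
  by apply: (ul [set y | normc (l - y) < d]); apply/nbhs_complexP; exists d.
by apply: filterS (ul d d0) => x; exact: dA.
Qed.

Lemma cvg_real_complex {T : Type} {F : set_system T} {FF : Filter F}
    (u : T -> R) (l : R) : u @ F --> l -> (fun x => (u x)%:C) @ F --> l%:C.
Proof.
move=> /cvgrPdist_lt ul; apply/cvg_complexP => d /ul.
by apply: filterS => x; rewrite -rmorphB normcR.
Qed.

Lemma cvg_complex_parts {T : Type} {F : set_system T} {FF : Filter F}
    (u : T -> R[i]) (a b : R) :
  (fun x => complex.Re (u x)) @ F --> a -> (fun x => complex.Im (u x)) @ F --> b ->
  u @ F --> a +i* b.
Proof.
move=> /cvgrPdist_lt ua /cvgrPdist_lt ub; apply/cvg_complexP => d d0.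
have d20 : 0 < d / 2 by rewrite divr_gt0.
apply: filterS2 (ua _ d20) (ub _ d20) => x ax bx.
apply: le_lt_trans (normc_le _) _; rewrite [ltRHS]splitr ltrD//.
  by case: (u x) ax.
by case: (u x) bx.
Qed.

Lemma normc_sum_le {T : Type} (s : seq T) (f : T -> R[i]) :
  normc (\sum_(x <- s) f x) <= \sum_(x <- s) normc (f x).
Proof.
elim: s => [|x s IHs]; first by rewrite !big_nil normc0.
by rewrite !big_cons (le_trans (le_normcD _ _))// lerD2l.
Qed.

(** Absolute convergence is tested on the real and imaginary parts. *)
Lemma normc_series_cvg (u : R[i] ^nat) :
  cvgn (series (fun k => normc (u k))) ->
  cvgn (series u) /\ cvgn (series (fun k => `|u k|)).
Proof.
move=> cu.
have part (p : R[i] -> R) : (forall z, `|p z| <= normc z) ->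
    cvgn (series (fun k => p (u k))).
  move=> pn; apply: normed_cvg.
  apply: (series_le_cvg _ _ _ cu) => k; first exact: normr_ge0.
    exact: normc_ge0.
  exact: pn.
split.
  have cRe := part _ normr_Re; have cIm := part _ normr_Im.
  apply/cvg_ex; exists (limn (series (fun k => complex.Re (u k)))
    +i* limn (series (fun k => complex.Im (u k)))).
  apply: cvg_complex_parts.
    rewrite (_ : (fun n => _) = series (fun k => complex.Re (u k)))//.
    by apply/funext => n; rewrite /series /= raddf_sum.
  rewrite (_ : (fun n => _) = series (fun k => complex.Im (u k)))//.
  by apply/funext => n; rewrite /series /= raddf_sum.
apply/cvg_ex; exists (limn (series (fun k => normc (u k))))%:C.
rewrite (_ : series _ = (fun n => (series (fun k => normc (u k)) n)%:C)).
  exact: cvg_real_complex.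
by apply/funext => n; rewrite /series /= rmorph_sum.
Qed.

End ComplexLimits.

(** The elements of degree at most n form finite sets that exhaust the support X
    as n grows, which is how summation by degree is compared with summation along
    all finite subsets. *)
Section GradedSum.
Context {R : realType} {T : choiceType}.
Variables (X : set T) (N : T -> nat) (f : T -> R[i]) (B : R).
Let piece m : set T := [set x | X x /\ N x = m].
Hypothesis piece_finite : forall m, finite_set (piece m).
Hypothesis N_gt0 : forall x, X x -> (0 < N x)%N.
Hypothesis f_supp : forall x, ~ X x -> f x = 0.
Hypothesis f_bounded : forall J : {fset T}, {in J, forall x, X x} ->
  \sum_(x <- J) normc (f x) <= B.

Definition graded_term (k : nat) : R[i] :=
  \sum_(x <- fset_set [set x | X x /\ N x = k.+1]) f x.

Let below n : set T := [set x | X x /\ (N x <= n)%N].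

Lemma belowS n : below n.+1 = below n `|` piece n.+1.
Proof.
apply/seteqP; split=> [x [Xx]|x [[Xx xn]|[Xx xn]]].
- by rewrite leq_eqVlt => /orP[/eqP xn|xn]; [right|left].
- by split=> //; exact: leqW.
- by split; rewrite ?xn.
Qed.

Lemma below_finite n : finite_set (below n).
Proof.
elim: n => [|n IHn]; last by rewrite belowS finite_setU.
rewrite (_ : below 0 = set0)//; apply/seteqP; split=> // x [/N_gt0].
by case: (N x).
Qed.

Lemma sum_below {V : zmodType} (F : T -> V) n :
  \sum_(0 <= k < n) \sum_(x <- fset_set (piece k.+1)) F x =
  \sum_(x <- fset_set (below n)) F x.
Proof.
elim: n => [|n IHn].
  rewrite big_geq// (_ : below 0 = set0) ?fset_set0 ?big_seq_fset0//.
  by apply/seteqP; split=> // x [/N_gt0]; case: (N x).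
rewrite big_nat_recr//= IHn -big_cat /=; apply: perm_big; apply: uniq_perm.
- rewrite cat_uniq !fset_uniq andbT /=; apply/hasPn => x.
  rewrite !in_fset_set//; last exact: below_finite.
  rewrite inE => -[_ Nx]; apply/negP; rewrite inE => -[_].
  by rewrite Nx ltnn.
- exact: fset_uniq.
- move=> x; rewrite mem_cat !in_fset_set//; try exact: below_finite.
  by rewrite belowS in_setU.
Qed.

Let total n : R := \sum_(x <- fset_set (below n)) normc (f x).

Lemma total_nondecreasing : {homo total : m n / (m <= n)%N >-> m <= n}.
Proof.
move=> m n mn; apply: ler_sum_uniq_subset => [| |x|x].
- exact: fset_uniq.
- exact: fset_uniq.
- rewrite !in_fset_set ?inE; try exact: below_finite.
  by move=> [Xx xm]; split=> //; exact: leq_trans mn.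
- exact: normc_ge0.
Qed.

Lemma total_cvg : cvgn total.
Proof.
apply: nondecreasing_is_cvgn; first exact: total_nondecreasing.
exists B => _ [n _ <-]; apply: f_bounded => x.
by rewrite in_fset_set ?inE => [[]|]//; exact: below_finite.
Qed.

(** A finite set meets the support in finitely many degrees. *)
Lemma sum_le_total (J : {fset T}) : \sum_(x <- J) normc (f x) <= limn total.
Proof.
pose n := (\max_(x <- J) N x)%N.
apply: le_trans (nondecreasing_cvgn_le total_nondecreasing total_cvg n).
rewrite (bigID (fun x => x \in X)) /= [X in _ + X]big1 ?addr0; last first.
  by move=> x /negP xX; rewrite f_supp ?normc0// => Xx; apply: xX; rewrite inE.
rewrite -big_filter; apply: ler_sum_uniq_subset => [| |x|x].
- by rewrite filter_uniq.
- exact: fset_uniq.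
- rewrite mem_filter in_fset_set ?inE; last exact: below_finite.
  move=> /andP[/set_mem Xx xJ]; split=> //.
  exact: (@leq_bigmax_seq _ (enum_fset J) predT N x xJ isT).
- exact: normc_ge0.
Qed.

(** Both sums have the same limit: once a finite set contains all elements of
    degree at most n, the rest of its sum is bounded by the tail after n of the
    convergent series of moduli. *)
Lemma graded_sum :
  [/\ cvgn (series (fun k => `|graded_term k|)),
      cvgn (series graded_term),
      cvg (summability.partial_sum f @ summability.totally)
    & limn (series graded_term) =
      lim (summability.partial_sum f @ summability.totally)].
Proof.
have [cS cA] : cvgn (series graded_term) /\
    cvgn (series (fun k => `|graded_term k|)).
  apply: normc_series_cvg.
  pose a k := \sum_(x <- fset_set (piece k.+1)) normc (f x).
  apply: (@series_le_cvg _ _ a) => [k|k|k|]; first exact: normc_ge0.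
  - by apply: sumr_ge0 => x _; exact: normc_ge0.
  - exact: normc_sum_le.
  - rewrite (_ : series a = total); first exact: total_cvg.
    by apply/funext => n; rewrite /series /= sum_below.
have FT := @summability.totally_filter T.
set S := limn (series graded_term).
have SE : series graded_term = fun n => \sum_(x <- fset_set (below n)) f x.
  by apply/funext => n; rewrite /series /= sum_below.
have cvgJ : summability.partial_sum f @ summability.totally --> S.
  apply/cvg_complexP => d d0; have d20 : 0 < d / 2 by rewrite divr_gt0.
  have /cvg_complexP/(_ _ d20) := cS : series graded_term @ \oo --> S.
  have /cvgrPdist_lt/(_ _ d20) := total_cvg : total @ \oo --> limn total.
  move=> [n1 _ tot1] [n2 _ ser2].
  pose n := maxn n1 n2.
  have totn := tot1 n (leq_maxl n1 n2); have sern := ser2 n (leq_maxr n1 n2).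
  exists (fset_set (below n)) => // J /= nJ.
  have splitJ (V : zmodType) (F : T -> V) : \sum_(x <- J) F x =
      \sum_(x <- fset_set (below n)) F x +
      \sum_(x <- (J `\` fset_set (below n))%fset) F x.
    rewrite -big_cat /=; apply: perm_big; apply: uniq_perm => [||x].
    - exact: fset_uniq.
    - rewrite cat_uniq !fset_uniq andbT /=; apply/hasPn => x.
      by rewrite in_fsetD => /andP[].
    - rewrite mem_cat in_fsetD.
      by case: (boolP (x \in fset_set (below n))) => //= /(fsubsetP nJ).
  rewrite /summability.partial_sum -(big_seq_fsetE _ J predT f) /= splitJ.
  rewrite opprD addrA; apply: le_lt_trans (le_normcD _ _) _.
  rewrite [ltRHS]splitr; apply: ltrD; first by move: sern; rewrite /= SE.
  rewrite normcN; apply: le_lt_trans (normc_sum_le _ _) _.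
  have := sum_le_total J; rewrite splitJ -/(total n).
  by move: totn => /= /ltr_normlW; lra.
have limE := @cvg_lim _ (@norm_hausdorff _ R[i]) _ _ _ _ _ cvgJ.
split; [exact: cA|exact: cS| |exact: (esym (limE FT))].
by apply/cvg_ex; exists S.
Qed.

End GradedSum.

(** * The Dirichlet series *)

Section DirichletTerms.
Context {R : realType}.

Lemma normc_natpowC (n : nat) (s : R[i]) : (0 < n)%N ->
  normc (natpowC n s) = n%:R `^ complex.Re s.
Proof.
move=> n0; rewrite /natpowC /expC /= !exprMn -mulrDr cos2Dsin2 mulr1 sqrtr_sqr.
rewrite ger0_norm ?expR_ge0// /powR pnatr_eq0 gtn_eqF//.
by case: s => a b /=; rewrite mulr0 subr0.
Qed.

Context {G : set R[i]}.
Hypothesis latG : planar_lattice G.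
Local Notation O := (multiplier_ring G).
Hypothesis O_neqZ : O <> range (intr : int -> R[i]).

Lemma ideal_index_gt0 I : nonzero_principal_ideals O I ->
  (0 < subgroup_index O I)%N.
Proof.
move=> /(nonzero_principal_idealsP latG)[a [a0 Oa ->]].
apply: subgroup_index_gt0; first exact: (multiplier_ring_subgroup latG).1.
exact: ideal_finite_index.
Qed.

Lemma ssl_dirichlet_termE s :
  ssl_dirichlet_term G s =
  graded_term (nonzero_principal_ideals O) (subgroup_index O)
    (ideal_dirichlet_term O s).
Proof.
apply/funext => k; rewrite /ssl_dirichlet_term /graded_term /ssl_count /=.
rewrite (card_eq_fset_set (ssl_of_index_card_eq latG O_neqZ k.+1)).
rewrite -/(ideals_of_index k.+1) big_seq.
rewrite (eq_bigr (fun=> 1 / natpowC k.+1 s)) => [|I]; last first.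
  rewrite in_fset_set; last exact: ideals_of_index_finite.
  by move=> /set_mem[XI NI]; rewrite /ideal_dirichlet_term mem_set// NI.
by rewrite -big_seq big_const_seq count_predT iter_addr_0 mul1r mulr_natl.
Qed.

Lemma ideal_dirichlet_bounded (s : R[i]) : 2 < complex.Re s -> exists B : R,
  forall J : {fset set R[i]},
    {in J, forall I, nonzero_principal_ideals O I} ->
    \sum_(I <- J) normc (ideal_dirichlet_term O s I) <= B.
Proof.
move=> /(ideal_sum_bounded latG O_neqZ)[B JB]; exists B => J JO.
apply: le_trans (JB J JO); rewrite big_seq [leRHS]big_seq.
apply: ler_sum => I /JO XI.
rewrite /ideal_dirichlet_term mem_set// mul1r normcV normc_natpowC//.
exact: ideal_index_gt0.
Qed.

End DirichletTerms.

Theorem proposition2 (R : realType) (G O : set R[i]) (latG : planar_lattice G)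
    (mrG : multiplier_ring G = O) (O_neqZ : O <> range (intr : int -> R[i])) :
  [/\ exists2 phi : set R[i] -> set R[i],
        set_bij (similar_sublattices G) (nonzero_principal_ideals O) phi
      & forall L, similar_sublattices G L ->
          [/\ finite_set (add_cosets G L), finite_set (add_cosets O (phi L))
            & subgroup_index G L = subgroup_index O (phi L)],
      forall m : nat, (0 < m)%N -> finite_set (similar_sublattices_of_index G m)
    & forall s : R[i], 2 < complex.Re s ->
        [/\ cvgn (series (fun k => `|ssl_dirichlet_term G s k|)),
            cvgn (series (ssl_dirichlet_term G s)),
            cvg (summability.partial_sum (ideal_dirichlet_term O s)
                   @ summability.totally)
          & limn (series (ssl_dirichlet_term G s)) =
            lim (summability.partial_sum (ideal_dirichlet_term O s)
                   @ summability.totally)]].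
Proof.
move: O_neqZ; rewrite -mrG => {}O_neqZ; split.
- exists (ideal_of_sublattice (G := G)); first exact: ideal_of_sublattice_bij.
  move=> _ /similar_sublatticesP[a [a0 Oa ->]]; rewrite ideal_of_dilate//.
  split; [exact: sublattice_finite_index|exact: ideal_finite_index|].
  exact: index_sublattice_ideal.
- move=> m _; rewrite (eq_finite_set (ssl_of_index_card_eq latG O_neqZ m)).
  exact: ideals_of_index_finite.
- move=> s s2; rewrite (ssl_dirichlet_termE latG O_neqZ).
  have [B sumB] := ideal_dirichlet_bounded latG O_neqZ s s2.
  apply: (graded_sum _ _ _ B) => //.
  + exact: ideals_of_index_finite.
  + exact: ideal_index_gt0.
  + by move=> I XI; rewrite /ideal_dirichlet_term memNset.
Qed.
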